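(* Let $p,q$ be prime numbers such that $p\equiv 1\pmod q$, and let $B$ be a left cancellative left semi-brace such that $|B|=pq$. Let $E$ be the set of idempotents of $(B,+)$, suppose that $|E|>1$, and let $\alpha$ be an injective homomorphism from $\mathbb{Z}/q\mathbb{Z}$ to $\mathrm{Aut}(\mathbb{Z}/p\mathbb{Z},+)$. Then, up to isomorphism, $B$ is one of the following left semi-braces: 1) $(B,\circ)=\mathbb{Z}/p\mathbb{Z}\rtimes_\alpha\mathbb{Z}/q\mathbb{Z}$, $E=B$ and $a+b:=b$ for all $a,b\in B$; 2) $(B,\circ)=\mathbb{Z}/p\mathbb{Z}\times\mathbb{Z}/q\mathbb{Z}$, $E=B$ and $a+b:=b$ for all $a,b\in B$; 3) $B=\mathbb{Z}/p\mathbb{Z}\times\mathbb{Z}/q\mathbb{Z}$ as a set, $(g_1,e_1)+(g_2,e_2)=(g_1+g_2,e_2)$ and $(g_1,e_1)\circ(g_2,e_2)=(g_1+\alpha_{e_1}(g_2),e_1+e_2)$ for all $(g_1,e_1),(g_2,e_2)\in B$ (here $G=\mathbb{Z}/p\mathbb{Z}\times\{0\}$, $E=\{0\}\times\mathbb{Z}/q\mathbb{Z}$); 4) $B=\mathbb{Z}/p\mathbb{Z}\times\mathbb{Z}/q\mathbb{Z}$ as a set, $(e_1,g_1)+(e_2,g_2)=(e_2,g_1+g_2)$ and $(e_1,g_1)\circ(e_2,g_2)=(e_1+\alpha_{g_1}(e_2),g_1+g_2)$ for all $(e_1,g_1),(e_2,g_2)\in B$ (here $E=\mathbb{Z}/p\mathbb{Z}\times\{0\}$,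 $G=\{0\}\times\mathbb{Z}/q\mathbb{Z}$); 5) $B=\mathbb{Z}/p\mathbb{Z}\times\mathbb{Z}/q\mathbb{Z}$ as a set, $(g_1,e_1)+(g_2,e_2)=(g_1+g_2,e_2)$ and $(g_1,e_1)\circ(g_2,e_2)=(g_1+g_2,e_1+e_2)$ for all $(g_1,e_1),(g_2,e_2)\in B$ (here $G=\mathbb{Z}/p\mathbb{Z}\times\{0\}$, $E=\{0\}\times\mathbb{Z}/q\mathbb{Z}$); 6) $B=\mathbb{Z}/q\mathbb{Z}\times\mathbb{Z}/p\mathbb{Z}$ as a set, $(g_1,e_1)+(g_2,e_2)=(g_1+g_2,e_2)$ and $(g_1,e_1)\circ(g_2,e_2)=(g_1+g_2,e_1+e_2)$ for all $(g_1,e_1),(g_2,e_2)\in B$ (here $G=\mathbb{Z}/q\mathbb{Z}\times\{0\}$, $E=\{0\}\times\mathbb{Z}/p\mathbb{Z}$).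
   Context: A left semi-brace is a triple $(B,+,\circ)$ where $(B,+)$ is a semigroup, $(B,\circ)$ is a group and $a\circ(b+c)=a\circ b+a\circ(a^-+c)$ for all $a,b,c\in B$, where $a^-$ is the inverse of $a$ in $(B,\circ)$ and $\circ$ has higher precedence than $+$. It is left cancellative if $(B,+)$ is left cancellative. The neutral element of $(B,\circ)$ is denoted by $0$, and $G:=B+0=\{b+0\mid b\in B\}$. Isomorphisms are bijections preserving both operations. In the list, inside the components the symbol $+$ is the usual modular addition, and $\mathbb{Z}/p\mathbb{Z}\rtimes_\alpha\mathbb{Z}/q\mathbb{Z}$ is the group semidirect product with operation $(a,b)\circ(c,d)=(a+\alpha_b(c),b+d)$. *)

(* Defs.v *)
From HB Require Import structures.
From mathcomp Require Import all_boot all_order all_fingroup all_algebra.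

Set Implicit Arguments.
Unset Strict Implicit.
Unset Printing Implicit Defensive.

Import GRing.Theory.

Local Open Scope group_scope.

(* The group (B, o) of a left semi-brace is the MathComp group structure of B:
   a o b is [a * b], a^- is [a^-1], and the neutral element, written 0 in the
   literature, is [1]. The semigroup operation a + b is written [a [+] b]. *)

Reserved Notation "a [+] b" (at level 50, left associativity).

HB.mixin Record Group_isLeftSemiBrace B of monoid.Group B := {
  sadd : B -> B -> B;
  saddA : associative sadd;
  mul_sadd : forall a b c : B,
    a * sadd b c = sadd (a * b) (a * sadd a^-1 c)
}.

#[short(type="leftSemiBraceType")]
HB.structure Definition LeftSemiBrace :=
  {B of Group_isLeftSemiBrace B & monoid.Group B}.

#[short(type="finLeftSemiBraceType")]
HB.structure Definition FinLeftSemiBrace :=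
  {B of LeftSemiBrace B & Finite B}.

Bind Scope group_scope with LeftSemiBrace.sort.
Bind Scope group_scope with FinLeftSemiBrace.sort.

Notation "a [+] b" := (sadd a b) : group_scope.

(* [right_injective op] says that each [op a] is injective. *)
Definition left_cancellative (B : leftSemiBraceType) : Prop :=
  right_injective (@sadd B).

Definition isomorphic (B C : leftSemiBraceType) : Prop :=
  exists f : B -> C,
    [/\ bijective f,
        {morph f : a b / a [+] b} & {morph f : a b / a * b}].

Definition idempotents (B : finLeftSemiBraceType) : {set B} :=
  [set a | a [+] a == a].

(* G = B + 0 *)
Definition Gpart (B : finLeftSemiBraceType) : {set B} :=
  [set b [+] 1 | b : B].

Section RightZero.
Variable gT : finGroupType.

Definition right_zero_brace : Type := gT.
HB.instance Definition _ := FinGroup.on right_zero_brace.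

Definition right_zero_add (a b : right_zero_brace) : right_zero_brace := b.

Fact right_zero_addA : associative right_zero_add.
Proof. by []. Qed.

Fact right_zero_mul_add (a b c : right_zero_brace) :
  a * right_zero_add b c =
    right_zero_add (a * b) (a * right_zero_add a^-1 c).
Proof. by []. Qed.

HB.instance Definition _ := Group_isLeftSemiBrace.Build right_zero_brace
  right_zero_addA right_zero_mul_add.
End RightZero.

(* As a [finGroupType], 'Z_n is the additive group of the integers mod n, so
   alpha below sends sums to products (compositions) of automorphisms. *)
Notation ZAut_hom p q :=
  {morphism [set: 'Z_q] >-> [subg Aut [set: 'Z_p]]}.

(* alpha is a dummy argument selecting the group structure. *)
Definition semidirect (p q : nat) (alpha : ZAut_hom p q) : Type :=
  ('Z_p * 'Z_q)%type.

Section SemidirectProduct.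
Variables (p q : nat) (alpha : ZAut_hom p q).

Definition aut_act (b : 'Z_q) (a : 'Z_p) : 'Z_p := sgval (alpha b) a.

Fact aut_actD b : {morph aut_act b : x y / (x + y)%R}.
Proof.
move=> x y; have /setIdP[_ /morphicP m] := subgP (alpha b).
by rewrite /aut_act; apply: m; rewrite inE.
Qed.

Fact aut_act_comp b c x : aut_act (b + c)%R x = aut_act b (aut_act c x).
Proof.
rewrite /aut_act addrC (_ : (c + b)%R = c * b) //.
by rewrite morphM ?inE // sgvalM ?inE // permM.
Qed.

Fact aut_act0 x : aut_act 0%R x = x.
Proof. by rewrite /aut_act (_ : 0%R = 1 :> 'Z_q) // morph1 perm1. Qed.

Local Notation semidirect := (semidirect alpha).
HB.instance Definition _ := Finite.on semidirect.

Definition semidirect_mul (x y : semidirect) : semidirect :=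
  ((x.1 + aut_act x.2 y.1)%R, (x.2 + y.2)%R).
Definition semidirect_one : semidirect := (0%R, 0%R).
Definition semidirect_inv (x : semidirect) : semidirect :=
  (aut_act (- x.2)%R (- x.1)%R, (- x.2)%R).

Fact semidirect_mulA : associative semidirect_mul.
Proof.
move=> x y z; congr (_, _) => /=; last by rewrite addrA.
by rewrite aut_actD addrA -aut_act_comp.
Qed.

Fact semidirect_mul1 : left_id semidirect_one semidirect_mul.
Proof. by case=> x y; rewrite /semidirect_mul /= aut_act0 !add0r. Qed.

Fact semidirect_mulV :
  left_inverse semidirect_one semidirect_inv semidirect_mul.
Proof.
move=> x; congr (_, _) => /=; last by rewrite addNr.
rewrite -aut_actD addNr.
by apply: (addIr (aut_act (- x.2)%R 0%R)); rewrite -aut_actD !add0r.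
Qed.

HB.instance Definition _ := Finite_isGroup.Build semidirect
  semidirect_mulA semidirect_mul1 semidirect_mulV.

Fact aut_act00 b : aut_act b 0%R = 0%R.
Proof. by apply: (addIr (aut_act b 0%R)); rewrite -aut_actD !add0r. Qed.

Definition semidirect_GE : Type := semidirect.
HB.instance Definition _ := FinGroup.on semidirect_GE.

Definition semidirect_GE_add (x y : semidirect_GE) : semidirect_GE :=
  ((x.1 + y.1)%R, y.2).

Fact semidirect_GE_addA : associative semidirect_GE_add.
Proof. by move=> x y z; rewrite /semidirect_GE_add /= addrA. Qed.

Fact semidirect_GE_mul_add (a b c : semidirect_GE) :
  a * semidirect_GE_add b c =
    semidirect_GE_add (a * b) (a * semidirect_GE_add a^-1 c).
Proof.
congr (_, _); rewrite /= !aut_actD -aut_act_comp subrr aut_act0.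
by rewrite addNKr addrA.
Qed.

HB.instance Definition _ := Group_isLeftSemiBrace.Build semidirect_GE
  semidirect_GE_addA semidirect_GE_mul_add.

Definition semidirect_EG : Type := semidirect.
HB.instance Definition _ := FinGroup.on semidirect_EG.

Definition semidirect_EG_add (x y : semidirect_EG) : semidirect_EG :=
  (y.1, (x.2 + y.2)%R).

Fact semidirect_EG_addA : associative semidirect_EG_add.
Proof. by move=> x y z; rewrite /semidirect_EG_add /= addrA. Qed.

Fact semidirect_EG_mul_add (a b c : semidirect_EG) :
  a * semidirect_EG_add b c =
    semidirect_EG_add (a * b) (a * semidirect_EG_add a^-1 c).
Proof. by congr (_, _); rewrite /= addNKr addrA. Qed.

HB.instance Definition _ := Group_isLeftSemiBrace.Build semidirect_EG
  semidirect_EG_addA semidirect_EG_mul_add.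
End SemidirectProduct.

Section DirectProduct.
Variables m n : nat.

Definition direct_GE : Type := ('Z_m * 'Z_n)%type.
HB.instance Definition _ := FinGroup.on direct_GE.

Fact direct_mulE (x y : direct_GE) :
  x * y = ((x.1 + y.1)%R, (x.2 + y.2)%R).
Proof. by []. Qed.

Definition direct_GE_add (x y : direct_GE) : direct_GE :=
  ((x.1 + y.1)%R, y.2).

Fact direct_GE_addA : associative direct_GE_add.
Proof. by move=> x y z; rewrite /direct_GE_add /= addrA. Qed.

Fact direct_GE_mul_add (a b c : direct_GE) :
  a * direct_GE_add b c =
    direct_GE_add (a * b) (a * direct_GE_add a^-1 c).
Proof. by rewrite !direct_mulE; congr (_, _); rewrite /= addNKr addrA. Qed.

HB.instance Definition _ := Group_isLeftSemiBrace.Build direct_GE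
  direct_GE_addA direct_GE_mul_add.
End DirectProduct.

(* Main.v *)
(* In a left cancellative left semi-brace, E and G = B + 0 are subgroups of
   (B, o) with G E = B and trivial intersection. If G is normal then
   g + e = g o e, and if E is normal then g + e = e o g, for g in G and e in E;
   if |G| is prime, then + and o agree on G, because
   lambda_a(b) = a o (a^- + b) defines an action of (G, o) on G fixing 0. As
   (a + e) + b = a + b for e in E, the addition is thus determined by o, G
   and E. When |B| = pq, the subgroup of order p is normal, and (B, o) is the
   direct product or the twisted product by alpha of its subgroups of orders p
   and q. *)

Require Import Defs.
From mathcomp Require Import all_boot all_order all_fingroup all_algebra.
From mathcomp Require Import all_solvable.

Set Implicit Arguments.
Unset Strict Implicit.
Unset Printing Implicit Defensive.

Import GRing.Theory.

Local Open Scope group_scope.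

(** * Left cancellative semi-braces: the maps lambda, the subgroups [E] and [G], and the sum *)

Section LeftCancellativeSemiBrace.
Variable B : finLeftSemiBraceType.
Hypothesis cancB : left_cancellative B.
Implicit Types a b c x y : B.

Local Notation E := (idempotents B).
Local Notation G := (Gpart B).

Definition lambda a b := a * (a^-1 [+] b).

(** The axiom at [a = b = 1] reads [1 [+] x = 1 [+] (1 [+] x)], and one [1] cancels. *)
Lemma add1s x : 1 [+] x = x.
Proof.
apply: (@cancB 1); have := mul_sadd (1 : B) 1 x.
by rewrite !mul1g invg1 => <-.
Qed.

Lemma mul_sadd_lambda a b c : a * (b [+] c) = a * b [+] lambda a c.
Proof. exact: mul_sadd. Qed.

Lemma lambda1 x : lambda 1 x = x.
Proof. by rewrite /lambda mul1g invg1 add1s. Qed.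

Lemma lambdaM a b x : lambda (a * b) x = lambda a (lambda b x).
Proof.
rewrite {1}/lambda -mulgA invMg mul_sadd_lambda mulKVg.
by rewrite /lambda.
Qed.

Lemma idempotents_addl a b : a \in E -> a [+] b = b.
Proof.
by rewrite inE => /eqP aa; apply: (@cancB a); rewrite saddA aa.
Qed.

Lemma in_idempotents a : (a \in E) = (a [+] 1 == 1).
Proof.
apply/idP/eqP => [/idempotents_addl // | a1].
by rewrite inE -[X in _ [+] X]add1s saddA a1 add1s.
Qed.

Lemma sadd1D a x : (a [+] 1) [+] x = a [+] x.
Proof. by rewrite -saddA add1s. Qed.

Lemma in_Gpart a : (a \in G) = (a [+] 1 == a).
Proof.
apply/imsetP/eqP => [[b _ ->] | <-]; last by exists a.
by rewrite sadd1D.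
Qed.

(** The axiom at [b = c = 1] gives [a = a [+] lambda a 1], and [a] can be cancelled. So [G] is the
    stabilizer of [1] under lambda, hence a subgroup. *)
Lemma in_Gpart_lambda a : (a \in G) = (lambda a 1 == 1).
Proof.
have aE : a = a [+] lambda a 1.
  by have := mul_sadd_lambda a 1 1; rewrite add1s mulg1.
rewrite in_Gpart; apply/eqP/eqP => [a1 | l1].
  by apply: (@cancB a); rewrite a1 -aE.
by rewrite {2}aE l1.
Qed.

(** With [1] written as [lambda a c], the axiom turns the sum into [a * (b [+] c)], where the
    idempotent [b] drops out. Thus [a [+] 1] depends only on the left coset of [a] modulo [E]. *)
Lemma mul_idempotent_add1 a b : b \in E -> a * b [+] 1 = a [+] 1.
Proof.
move=> /idempotents_addl bE; set c := lambda a^-1 1.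
have lc : lambda a c = 1 by rewrite /c -lambdaM mulgV lambda1.
by rewrite -{1}lc -mul_sadd_lambda bE /c {1}/lambda invgK mulKVg.
Qed.

(** Conversely, the fibres of [a [+] 1] are single cosets: [a] and [b] have the same left
    translations, so [a^-1 * (b [+] c) = a^-1 * (a [+] c)], which is [1] for [c = lambda a 1]. *)
Lemma add1_eq_mulV a b : a [+] 1 = b [+] 1 -> a^-1 * b \in E.
Proof.
move=> eq_ab; rewrite in_idempotents; apply/eqP.
have eqD x : a [+] x = b [+] x by rewrite -(sadd1D a) eq_ab sadd1D.
set c := lambda a 1; have lc : lambda a^-1 c = 1 by rewrite -lambdaM mulVg lambda1.
rewrite -{1}lc -mul_sadd_lambda -eqD mul_sadd_lambda mulVg lc.
by rewrite add1s.
Qed.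

Lemma group_set_idempotents : group_set E.
Proof.
apply/group_setP; split; first by rewrite inE add1s.
move=> a b; rewrite !in_idempotents => aE /eqP bE.
by rewrite mul_idempotent_add1 // in_idempotents bE.
Qed.
Canonical idempotents_group := Group group_set_idempotents.

Lemma group_set_Gpart : group_set G.
Proof.
apply/group_setP; split; first by rewrite in_Gpart add1s.
move=> a b; rewrite !in_Gpart_lambda lambdaM => la /eqP->.
by rewrite la.
Qed.
Canonical Gpart_group := Group group_set_Gpart.

Lemma Gpart_TI_idempotents : G :&: E = 1.
Proof.
apply/trivgP/subsetP => a /setIP[]; rewrite in_Gpart in_idempotents inE.
by move=> /eqP->.
Qed.

Lemma Gpart_mul_idempotents : G * E = [set: B].
Proof.
apply/setP => a; rewrite inE; apply/mulsgP.
(* The [G]-factor of [a] is [a [+] 1], which lies in the same left coset of [E] as [a]. *)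
exists (a [+] 1) ((a [+] 1)^-1 * a); last by rewrite mulKVg.
  by rewrite in_Gpart sadd1D.
by apply: add1_eq_mulV; rewrite sadd1D.
Qed.

Lemma card_Gpart_idempotents : (#|G| * #|E|)%N = #|B|.
Proof.
by rewrite -cardsT -Gpart_mul_idempotents TI_cardMg // Gpart_TI_idempotents.
Qed.

Lemma lambda_idempotent e x : e \in E -> lambda e x = e * x.
Proof.
move=> eE; rewrite -{2}(add1s x) mul_sadd_lambda mulg1.
by rewrite idempotents_addl.
Qed.

(** Distributing [e] over [g = g [+] 1] writes a product as a sum of an element of [G] and one of
    [E]; under either normality hypothesis the [G]-term can be identified. *)
Lemma idempotent_mul_Gpart e g :
  e \in E -> g \in G -> e * g = (e * g [+] 1) [+] e.
Proof.
move=> eE; rewrite in_Gpart sadd1D => /eqP g1.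
by rewrite -{1}g1 mul_sadd_lambda lambda_idempotent ?mulg1.
Qed.

(** Here [g * e = e * g ^ e] with [g ^ e] in [G], and its [G]-term is [g * e [+] 1 = g [+] 1 =
    g]. *)
Lemma Gpart_norm_add g e :
  [set: B] \subset 'N(G) -> g \in G -> e \in E -> g [+] e = g * e.
Proof.
move=> nG gG eE; have gG' : g ^ e \in G.
  by rewrite memJ_norm // (subsetP nG) ?inE.
have := idempotent_mul_Gpart eE gG'; rewrite -conjgC => ->.
by rewrite mul_idempotent_add1 // sadd1D.
Qed.

Lemma idempotents_norm_add g e :
  [set: B] \subset 'N(E) -> g \in G -> e \in E -> g [+] e = e * g.
Proof.
move=> nE gG eE; rewrite (idempotent_mul_Gpart eE gG) conjgC.
rewrite mul_idempotent_add1 ?sadd1D //.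
by rewrite memJ_norm // (subsetP nE) ?inE.
Qed.

(** The inverse turns the left action lambda into a right action, as [action] requires. *)
Definition lambda_act x a := lambda a^-1 x.

Lemma lambda_act1 : lambda_act^~ 1 =1 id.
Proof. by move=> x; rewrite /lambda_act invg1 lambda1. Qed.

Lemma lambda_actM x : act_morph lambda_act x.
Proof. by move=> a b; rewrite /lambda_act invMg lambdaM. Qed.

Canonical lambda_action := TotalAction lambda_act1 lambda_actM.

(* For h != 1, the orbit of h under lambda avoids 1, so its cardinal is a
   divisor of the prime #|G| which is smaller than #|G|. *)
Lemma prime_Gpart_add g h :
  prime #|G| -> g \in G -> h \in G -> g [+] h = g * h.
Proof.
move=> prG gG hG; suff lh : lambda g h = h.
  by rewrite -[h in g * h]add1s mul_sadd_lambda mulg1 lh.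
have [-> | nth] := eqVneq h 1; first by apply/eqP; rewrite -in_Gpart_lambda.
have sO : orbit lambda_action G h \subset G^#.
  apply/subsetP => _ /imsetP[a aG ->]; rewrite -groupV in aG.
  have lG : lambda a^-1 h \in G.
    rewrite groupM // in_Gpart -saddA; rewrite in_Gpart in hG.
    by rewrite (eqP hG).
  rewrite !inE lG andbT; apply: contra nth => /eqP /= l1.
  rewrite -groupV in_Gpart_lambda invgK in aG.
  by rewrite -(eqP aG) -{1}l1 -lambdaM mulgV lambda1.
have cO : #|orbit lambda_action G h| = 1%N.
  have [_] := primeP prG.
  move/(_ #|orbit lambda_action G h|); rewrite card_orbit dvdn_indexg -card_orbit.
  move=> /(_ isT)/pred2P[// | oG]; have := subset_leq_card sO.
  by rewrite oG (cardsD1 1 G) group1 ltnn.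
have /eqP/cards1P[x oE] := cO.
have := orbit_refl lambda_action G h; rewrite oE inE => /eqP hx.
have : lambda_action h g^-1 \in orbit lambda_action G h.
  by apply: mem_orbit; rewrite groupV.
by rewrite oE inE /= /lambda_act invgK -hx => /eqP.
Qed.

(** Once the products are read as sums, the inner idempotent [e1] is a left identity for [[+]] and
    disappears. *)
Lemma Gpart_norm_sadd g1 e1 g2 e2 :
  prime #|G| -> [set: B] \subset 'N(G) ->
  g1 \in G -> e1 \in E -> g2 \in G -> e2 \in E ->
  (g1 * e1) [+] (g2 * e2) = g1 * g2 * e2.
Proof.
move=> prG nG g1G e1E g2G e2E.
have g12G : g1 * g2 \in G by rewrite groupM.
rewrite -(Gpart_norm_add nG g1G e1E) -(Gpart_norm_add nG g2G e2E).
rewrite -(Gpart_norm_add nG g12G e2E) -saddA (idempotents_addl _ e1E).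
by rewrite saddA (prime_Gpart_add prG g1G g2G).
Qed.

Lemma idempotents_norm_sadd e1 g1 e2 g2 :
  prime #|G| -> [set: B] \subset 'N(E) ->
  e1 \in E -> g1 \in G -> e2 \in E -> g2 \in G ->
  (e1 * g1) [+] (e2 * g2) = e2 * (g1 * g2).
Proof.
move=> prG nE e1E g1G e2E g2G.
have g12G : g1 * g2 \in G by rewrite groupM.
rewrite -(idempotents_norm_add nE g1G e1E) -(idempotents_norm_add nE g2G e2E).
rewrite -(idempotents_norm_add nE g12G e2E) -saddA (idempotents_addl _ e1E).
by rewrite saddA (prime_Gpart_add prG g1G g2G).
Qed.
End LeftCancellativeSemiBrace.

(** * Groups of order pq and pairs of exponents *)

Section GroupOfOrderPQ.
Variables (gT : finGroupType) (p q : nat).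
Hypotheses (p_pr : prime p) (q_pr : prime q) (ltqp : q < p).
Hypothesis cardT : #|gT| = (p * q)%N.

(** The number of Sylow p-subgroups is 1 mod p, hence coprime to p, so it divides [q < p] and equals
    1. *)
Lemma order_pq_norm (P : {group gT}) : #|P| = p -> [set: gT] \subset 'N(P).
Proof.
move=> cP; have pP : p.-Sylow([set: gT]) P.
  rewrite pHallE subsetT /= cP cardsT cardT.
  by rewrite p_part lognM ?prime_gt0 // !(logn_prime p) // eqxx (gtn_eqF ltqp).
have s1 : #|'Syl_p([set: gT])| = 1%N.
  have sd := card_Syl_dvd p [set: gT]; have sm := card_Syl_mod [set: gT] p_pr.
  move: sd sm; rewrite cardsT cardT; set s := #|_| => sd sm.
  have cps : coprime s p.
    by rewrite coprime_sym prime_coprime // /dvdn sm.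
  rewrite Gauss_dvdr // in sd.
  by rewrite -sm modn_small // (leq_ltn_trans (dvdn_leq _ sd)) // prime_gt0.
have /eqP/normal_sylowP[Q pQ nQ] := s1.
have [x _ ->] := Sylow_trans pQ pP.
by rewrite (normP _) ?normal_norm // (subsetP (normal_norm nQ)) // inE.
Qed.

Lemma expg_ZpD (n : nat) (x : gT) (a b : 'Z_n) :
  1 < n -> #[x] = n -> x ^+ (a + b)%R = x ^+ a * x ^+ b.
Proof.
by move=> n1 ox; rewrite -expgD /= [in X in _ %% X]Zp_cast // expg_mod // -ox expg_order.
Qed.

Definition pair_exp m n (x y : gT) (u : 'Z_m * 'Z_n) : gT := x ^+ u.1 * y ^+ u.2.

Lemma pair_exp_bij x y : #[x] = p -> #[y] = q -> bijective (@pair_exp p q x y).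
Proof.
move=> ox oy; have [p1 q1] := (prime_gt1 p_pr, prime_gt1 q_pr).
apply: inj_card_bij; last by rewrite card_prod !card_ord !Zp_cast // cardT.
have inj_exp n (z : gT) (a b : 'Z_n) : 1 < n -> #[z] = n -> z ^+ a = z ^+ b -> a = b.
  move=> n1 oz /eqP; rewrite eq_expg_mod_order oz.
  have lt_n (c : 'Z_n) : c < n by rewrite -[n in _ < n]Zp_cast.
  by rewrite !modn_small // => /eqP/val_inj.
have TI : <[x]> :&: <[y]> = 1.
  by rewrite coprime_TIg // -!orderE ox oy prime_coprime // dvdn_prime2 // gtn_eqF.
move=> [a b] [c d]; rewrite /pair_exp /= => eq_u.
(* Separating the powers of [x] from those of [y] puts both sides in the trivial intersection. *)
have eqc : (x ^+ c)^-1 * x ^+ a = y ^+ d * (y ^+ b)^-1.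
  by apply: (mulgI (x ^+ c)); rewrite mulKVg mulgA -eq_u mulgK.
have eq1 : (x ^+ c)^-1 * x ^+ a = 1.
  by apply/set1P; rewrite -[[set 1]]TI inE {2}eqc !groupM ?groupV ?mem_cycle.
congr (_, _).
  by apply: (inj_exp _ x) => //; apply/esym/eqP; rewrite eq_mulVg1 eq1.
by apply: (inj_exp _ y) => //; apply/esym/eqP; rewrite eq_mulgV1 -eqc eq1.
Qed.

Lemma prime_group_gen (n : nat) (P : {group gT}) :
  prime n -> #|P| = n -> exists2 x, P :=: <[x]> & #[x] = n.
Proof.
move=> n_pr cP; have /cyclicP[x eP] : cyclic P by rewrite prime_cyclic ?cP.
by exists x; rewrite // orderE -eP.
Qed.
End GroupOfOrderPQ.

(** * The action alpha as multiplication by powers of one scalar *)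

Section AutAct.
Variables (p q : nat) (alpha : ZAut_hom p q).
Local Open Scope ring_scope.

(** An additive map of Z/p is multiplication by its value at 1, so alpha is determined by the scalar
    [aut_act alpha 1 1]. *)
Lemma aut_actE b a : aut_act alpha b a = a * aut_act alpha b 1.
Proof.
rewrite -[a in LHS]natr_Zp -[a in RHS]natr_Zp; elim: (a : nat) => [|n IH].
  by rewrite mul0r aut_act00.
by rewrite mulrSr aut_actD IH mulrDl mul1r.
Qed.

Lemma aut_act_nat n : aut_act alpha n%:R 1 = aut_act alpha 1 1 ^+ n.
Proof.
elim: n => [|n IH]; first by rewrite aut_act0.
by rewrite mulrSr aut_act_comp aut_actE IH exprS.
Qed.

Lemma aut_act1_expr_eq1 : (1 < q)%N -> aut_act alpha 1 1 ^+ q = 1.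
Proof. by move=> q1; rewrite -aut_act_nat pchar_Zp // aut_act0. Qed.

Lemma aut_act1_neq1 : (1 < q)%N -> 'injm alpha -> aut_act alpha 1 1 != 1.
Proof.
move=> q1 /injmP inj; apply/eqP => a1.
(* [1] is the ring unit of ['Z_q], while [1%g] is its additive zero. *)
suff /inj : alpha 1 = alpha 1%g.
  by rewrite !inE => /(_ isT isT)/eqP; rewrite oner_eq0.
apply/val_inj/permP => a; rewrite morph1 perm1 -[LHS]/(aut_act alpha 1 a).
by rewrite aut_actE a1 mulr1.
Qed.
End AutAct.

(** * Matching the conjugation action with alpha *)

Lemma natr_Fp_eq (p a b : nat) : prime p ->
  (a%:R == b%:R :> 'F_p)%R = (a == b %[mod p]).
Proof. by move=> p_pr; rewrite -val_eqE /= !val_Fp_nat. Qed.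

Lemma conjg_expg (gT : finGroupType) (x y : gT) k n :
  x ^ y = x ^+ k -> x ^ (y ^+ n) = x ^+ (k ^ n).
Proof.
move=> xy; elim: n => [|n IH]; first by rewrite conjg1.
by rewrite expgSr conjgM IH conjXg xy -expgM expnS.
Qed.

(* The exponents k with k ^ q = 1 form a cyclic group of order q in F_p, so the
   action of y0 on x and that of alpha 1 on Z_p are powers of each other. *)
Lemma twisting_generator (p q : nat) (alpha : ZAut_hom p q)
    (gT : finGroupType) (x y0 : gT) :
  prime p -> prime q -> 'injm alpha -> #[x] = p -> #[y0] = q ->
  y0 \in 'N(<[x]>) -> ~ commute x y0 ->
  exists2 y, <[y]> = <[y0]> & y * x = x ^+ aut_act alpha 1%R 1%R * y.
Proof.
move=> p_pr q_pr inj ox oy nxy ncxy.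
have [p1 q1] := (prime_gt1 p_pr, prime_gt1 q_pr).
have eqx a b : (x ^+ a == x ^+ b) = (a%:R == b%:R :> 'F_p)%R.
  by rewrite natr_Fp_eq // eq_expg_mod_order ox.
have [k xy0] : exists k, x ^ y0^-1 = x ^+ k.
  by apply/cycleP; rewrite memJ_norm ?cycle_id // groupV.
have kq : (k%:R ^+ q = 1 :> 'F_p)%R.
  apply/eqP; rewrite -natrX -[1%R]/(1%:R)%R -eqx -(conjg_expg q xy0).
  by rewrite expgVn -oy expg_order invg1 conjg1.
(* The order of [k] divides the prime q; order 1 would make [x] and [y0] commute. *)
have prim_k : (q.-primitive_root (k%:R : 'F_p))%R.
  have [m prim_m /(prime_nt_dvdP q_pr) <- //] := prim_order_exists (prime_gt0 q_pr) kq.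
  apply: contra_notN ncxy => /eqP m1; have := prim_expr_order prim_m.
  rewrite m1 expr1 => /eqP; rewrite -[1%R]/(1%:R)%R -eqx -xy0 => /eqP xy.
  by apply/commgP/conjg_fixP; rewrite -{1}[x]expg1 -xy conjgKV.
set m : nat := aut_act alpha _ _.
have mq : (m%:R ^+ q = 1 :> 'F_p)%R.
  apply/eqP; rewrite -natrX -[1%R]/(1%:R)%R natr_Fp_eq //.
  rewrite -!val_Zp_nat // natrX /m natr_Zp.
  by rewrite aut_act1_expr_eq1.
have [i mE] := prim_rootP prim_k mq.
have xy : x ^ (y0 ^+ i)^-1 = x ^+ m.
  by rewrite -expgVn (conjg_expg _ xy0); apply/eqP; rewrite eqx mE natrX.
exists (y0 ^+ i); last by rewrite -xy conjgE invgK -!mulgA mulVg mulg1.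
(* A nontrivial power of [y0] generates; a trivial one would force the scalar of [alpha 1] to be
   1. *)
apply/esym/nt_gen_prime; first by rewrite -orderE oy.
rewrite !inE mem_cycle andbT; apply: contraTneq (aut_act1_neq1 q1 inj) => y1.
rewrite negbK -val_eqE /=; move/eqP: xy.
rewrite y1 invg1 conjg1 -{1}[x]expg1 eq_expg_mod_order ox.
have mp : m < p by rewrite -[X in _ < X](Zp_cast p1) ltn_ord.
by rewrite !modn_small // eq_sym.
Qed.

Lemma pair_exp_direct_morph (p q : nat) (gT : finGroupType) (x y : gT) :
  1 < p -> 1 < q -> #[x] = p -> #[y] = q -> commute x y ->
  {morph (@pair_exp gT p q x y : 'Z_p * 'Z_q -> gT) : u v / u * v}.
Proof.
move=> p1 q1 ox oy cxy [a b] [c d]; rewrite /pair_exp /=.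
rewrite [in X in X * _](expg_ZpD _ _ p1 ox) [in X in _ * X](expg_ZpD _ _ q1 oy).
by rewrite -!mulgA; congr (_ * _); rewrite !mulgA; congr (_ * _); apply: commuteX2.
Qed.

Lemma expg_Zp_nat (n : nat) (gT : finGroupType) (x : gT) k :
  1 < n -> #[x] = n -> x ^+ (k%:R : 'Z_n)%R = x ^+ k.
Proof. by move=> n1 ox; rewrite val_Zp_nat // expg_mod // -ox expg_order. Qed.

(** Iterating the relation, moving [y ^+ b] past [x ^+ c] multiplies the exponent [c] by
    [aut_act alpha b 1], which is the twisted product law. *)
Lemma pair_exp_semidirect_morph (p q : nat) (alpha : ZAut_hom p q)
    (gT : finGroupType) (x y : gT) :
  1 < p -> 1 < q -> #[x] = p -> #[y] = q ->
  y * x = x ^+ aut_act alpha 1%R 1%R * y ->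
  {morph (@pair_exp gT p q x y : semidirect alpha -> gT) : u v / u * v}.
Proof.
move=> p1 q1 ox oy yx [a b] [c d]; rewrite /pair_exp /=.
rewrite [in X in X * _](expg_ZpD _ _ p1 ox) [in X in _ * X](expg_ZpD _ _ q1 oy).
rewrite -!mulgA; congr (_ * _); rewrite !mulgA; congr (_ * _).
have xy : x ^ y^-1 = x ^+ aut_act alpha 1%R 1%R by rewrite conjgE invgK mulgA yx mulgK.
have xyb : x ^ (y ^+ b)^-1 = x ^+ aut_act alpha b 1%R.
  have -> : aut_act alpha b 1%R = (aut_act alpha 1%R 1%R ^+ b)%R.
    by rewrite -[b in LHS]natr_Zp aut_act_nat.
  rewrite -expgVn (conjg_expg _ xy) -[aut_act _ _ _ in RHS]natr_Zp -natrX.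
  by rewrite expg_Zp_nat.
rewrite aut_actE mulrC -[c in (_ * c)%R]natr_Zp mulr_natr.
rewrite -[aut_act alpha b 1%R]natr_Zp -mulrnA expg_Zp_nat // expgM -xyb -conjXg conjgE invgK.
by rewrite -!mulgA mulVg mulg1.
Qed.

(** Either the chosen generators commute, or the one of [Q] is replaced by a power matching alpha.
    [P] and [Q] are arbitrary, so that they can be [G] and [E] in either order. *)
Lemma order_pq_pair_exp (p q : nat) (alpha : ZAut_hom p q)
    (gT : finGroupType) (P Q : {group gT}) :
  prime p -> prime q -> q < p -> #|gT| = (p * q)%N -> 'injm alpha ->
  #|P| = p -> #|Q| = q ->
  exists x y, [/\ P :=: <[x]>, Q :=: <[y]>, bijective (@pair_exp gT p q x y) &
    {morph (@pair_exp gT p q x y : 'Z_p * 'Z_q -> gT) : u v / u * v} \/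
    {morph (@pair_exp gT p q x y : semidirect alpha -> gT) : u v / u * v}].
Proof.
move=> p_pr q_pr ltqp cT inj cP cQ.
have [p1 q1] := (prime_gt1 p_pr, prime_gt1 q_pr).
have [x Px ox] := prime_group_gen p_pr cP.
have [y0 Qy oy0] := prime_group_gen q_pr cQ.
have [/eqP cxy | /eqP ncxy] := boolP (x * y0 == y0 * x).
  exists x, y0; split=> //; first exact: pair_exp_bij.
  by left; apply: pair_exp_direct_morph.
have ny0 : y0 \in 'N(<[x]>).
  by rewrite -Px; apply: (subsetP (order_pq_norm p_pr q_pr ltqp cT cP)); rewrite inE.
have [y yy0 yx] := twisting_generator p_pr q_pr inj ox oy0 ny0 ncxy.
have oy : #[y] = q by rewrite orderE yy0 -orderE.
exists x, y; split=> //; first by rewrite Qy yy0.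
  exact: pair_exp_bij.
by right; apply: pair_exp_semidirect_morph.
Qed.

Lemma isomorphic_from (B C : leftSemiBraceType) (f : C -> B) :
  bijective f -> {morph f : a b / a [+] b} -> {morph f : a b / a * b} ->
  isomorphic B C.
Proof.
move=> [g fK gK] fD fM; exists g; split; first by exists f.
  by move=> a b; rewrite -{1}[a]gK -{1}[b]gK -fD fK.
by move=> a b; rewrite -{1}[a]gK -{1}[b]gK -fM fK.
Qed.

Lemma idempotents_right_zero (gT : finGroupType) :
  idempotents (right_zero_brace gT) = [set: right_zero_brace gT].
Proof. by apply/setP => a; rewrite !inE /= eqxx. Qed.

(** * The subsets [E] and [G] of the models *)

Section Models.
Variables (p q : nat) (alpha : ZAut_hom p q).

Lemma idempotents_semidirect_GE :
  idempotents (semidirect_GE alpha) = setX [set 0%R] [set: 'Z_q].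
Proof.
apply/setP => -[a b]; rewrite !inE andbT -[LHS]/((a + a, b)%R == (a, b)).
by rewrite xpair_eqE eqxx andbT -subr_eq0 addrK.
Qed.

Lemma Gpart_semidirect_GE :
  Gpart (semidirect_GE alpha) = setX [set: 'Z_p] [set 0%R].
Proof.
apply/setP => -[a b]; rewrite !inE /=.
apply/imsetP/eqP => [[[c d] _ /(congr1 snd)] // | /= ->].
by exists (a, 0%R) => //; congr (_, _); rewrite addr0.
Qed.

Lemma idempotents_semidirect_EG :
  idempotents (semidirect_EG alpha) = setX [set: 'Z_p] [set 0%R].
Proof.
apply/setP => -[a b]; rewrite !inE -[LHS]/((a, b + b)%R == (a, b)).
by rewrite xpair_eqE eqxx -subr_eq0 addrK.
Qed.

Lemma Gpart_semidirect_EG :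
  Gpart (semidirect_EG alpha) = setX [set 0%R] [set: 'Z_q].
Proof.
apply/setP => -[a b]; rewrite !inE andbT.
apply/imsetP/eqP => [[[c d] _ /(congr1 fst)] // | /= ->].
by exists (0%R, b) => //; congr (_, _); rewrite addr0.
Qed.

Lemma idempotents_direct_GE :
  idempotents (direct_GE p q) = setX [set 0%R] [set: 'Z_q].
Proof.
apply/setP => -[a b]; rewrite !inE andbT -[LHS]/((a + a, b)%R == (a, b)).
by rewrite xpair_eqE eqxx andbT -subr_eq0 addrK.
Qed.

Lemma Gpart_direct_GE :
  Gpart (direct_GE p q) = setX [set: 'Z_p] [set 0%R].
Proof.
apply/setP => -[a b]; rewrite !inE /=.
apply/imsetP/eqP => [[[c d] _ /(congr1 snd)] // | /= ->].
by exists (a, 0%R) => //; congr (_, _); rewrite addr0.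
Qed.
End Models.

(** * The classification, by the order of [G] *)

Theorem theorem4p7 (p q : nat) (B : finLeftSemiBraceType)
    (alpha : ZAut_hom p q) :
  prime p -> prime q -> p = 1 %[mod q] ->
  left_cancellative B ->
  #|B| = (p * q)%N ->
  1 < #|idempotents B| ->
  'injm alpha ->
  [\/ (let C : finLeftSemiBraceType := right_zero_brace (semidirect alpha) in
       isomorphic B C /\ idempotents C = [set: C]),
      (let C : finLeftSemiBraceType := right_zero_brace ('Z_p * 'Z_q)%type in
       isomorphic B C /\ idempotents C = [set: C]),
      (let C : finLeftSemiBraceType := semidirect_GE alpha in
       [/\ isomorphic B C,
           Gpart C = setX [set: 'Z_p] [set 0%R] &
           idempotents C = setX [set 0%R] [set: 'Z_q]]) |
      [\/ (let C : finLeftSemiBraceType := semidirect_EG alpha in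
           [/\ isomorphic B C,
               idempotents C = setX [set: 'Z_p] [set 0%R] &
               Gpart C = setX [set 0%R] [set: 'Z_q]]),
          (let C : finLeftSemiBraceType := direct_GE p q in
           [/\ isomorphic B C,
               Gpart C = setX [set: 'Z_p] [set 0%R] &
               idempotents C = setX [set 0%R] [set: 'Z_q]]) |
          (let C : finLeftSemiBraceType := direct_GE q p in
           [/\ isomorphic B C,
               Gpart C = setX [set: 'Z_q] [set 0%R] &
               idempotents C = setX [set 0%R] [set: 'Z_p]])]].
Proof.
move=> p_pr q_pr p1q cancB cB E1 inj.
have [p1 q1] := (prime_gt1 p_pr, prime_gt1 q_pr).
have ltqp : q < p.
  have : q %| p - 1 by rewrite -eqn_mod_dvd ?p1q // ltnW.
  move/dvdn_leq; rewrite subn_gt0 => /(_ p1) le_q.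
  by rewrite (leq_ltn_trans le_q) // subn1 ltn_predL ltnW.
pose E := idempotents_group cancB; pose G := Gpart_group cancB.
have cGE : (#|G| * #|E|)%N = (p * q)%N by rewrite card_Gpart_idempotents.
(* The order of [G] divides pq, and order pq is excluded by [1 < #|E|]. *)
have Gcases : [\/ #|G| = 1%N, #|G| = p /\ #|E| = q | #|G| = q /\ #|E| = p].
  have [/dvdnP[k Gk] | npG] := boolP (p %| #|G|).
    have kE : (k * #|E|)%N = q.
      by apply/eqP; rewrite -(eqn_pmul2l (ltnW p1)) mulnA [(p * k)%N]mulnC -Gk cGE.
    have [_ /(_ k)] := primeP q_pr; rewrite -{1}kE dvdn_mulr // => /(_ isT).
    case/pred2P => k1; first by apply: Or32; rewrite Gk -kE k1 !mul1n.
    move/eqP: kE E1; rewrite k1 -{2}[q]muln1 eqn_pmul2l ?(ltnW q1) // => /eqP E1.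
    by rewrite -[#|_|]/#|E| E1.
  have Gq : #|G| %| q.
    have Gpq : #|G| %| p * q by rewrite -cGE dvdn_mulr.
    by rewrite -(@Gauss_dvdr _ p) // coprime_sym prime_coprime.
  have [_ /(_ _ Gq)/pred2P[G1 | Gq']] := primeP q_pr; first exact: Or31.
  apply: Or33; split=> //; apply/eqP; rewrite -(eqn_pmul2l (ltnW q1)).
  by rewrite -{1}Gq' cGE mulnC.
case: Gcases => [G1 | [cG cE] | [cG cE]].
(* With [G] trivial, [E] is all of [B]; Cauchy supplies the subgroups of orders p and q. *)
- have EB (a b : B) : a [+] b = b.
    apply: (idempotents_addl cancB); suff -> : idempotents B = [set: B] by rewrite inE.
    apply/eqP; rewrite eqEcard subsetT cardsT -(card_Gpart_idempotents cancB).
    by rewrite -[#|Gpart B|]/#|G| G1 mul1n leqnn.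
  have [z _ oz] : {z | z \in [set: B] & #[z] = p}.
    by apply: Cauchy; rewrite // cardsT cB dvdn_mulr.
  have [t _ ot] : {t | t \in [set: B] & #[t] = q}.
    by apply: Cauchy; rewrite // cardsT cB dvdn_mull.
  have [x [y [_ _ fbij fM]]] := order_pq_pair_exp p_pr q_pr ltqp cB inj oz ot.
  case: fM => fM; [apply: Or42 | apply: Or41]; split; try exact: idempotents_right_zero.
    apply: (@isomorphic_from _ (right_zero_brace ('Z_p * 'Z_q)%type) _ fbij _ fM).
    by move=> a b; rewrite EB.
  apply: (@isomorphic_from _ (right_zero_brace (semidirect alpha)) _ fbij _ fM).
  by move=> a b; rewrite EB.
- have [x [y [Gx Ey fbij fM]]] := order_pq_pair_exp p_pr q_pr ltqp cB inj cG cE.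
  have nG : [set: B] \subset 'N(G) := order_pq_norm p_pr q_pr ltqp cB cG.
  have prG : prime #|G| by rewrite cG.
  have ox : #[x] = p by rewrite orderE -Gx.
  have Gx' n : x ^+ n \in Gpart B by rewrite -[Gpart B]/(G : {set B}) Gx mem_cycle.
  have Ey' n : y ^+ n \in idempotents B.
    by rewrite -[idempotents B]/(E : {set B}) Ey mem_cycle.
  have fD (a b : 'Z_p * 'Z_q) :
      pair_exp x y ((a.1 + b.1)%R, b.2) = pair_exp x y a [+] pair_exp x y b.
    by rewrite (Gpart_norm_sadd cancB prG nG) // /pair_exp /= -expg_ZpD.
  case: fM => fM.
    apply: Or44; apply: Or32; split; last exact: idempotents_direct_GE.
      exact: (@isomorphic_from _ (direct_GE p q) _ fbij fD fM).
    exact: Gpart_direct_GE.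
  apply: Or43; split; last exact: idempotents_semidirect_GE.
    exact: (@isomorphic_from _ (semidirect_GE alpha) _ fbij fD fM).
  exact: Gpart_semidirect_GE.
- have [x [y [Ex Gy fbij fM]]] := order_pq_pair_exp p_pr q_pr ltqp cB inj cE cG.
  have nE : [set: B] \subset 'N(E) := order_pq_norm p_pr q_pr ltqp cB cE.
  have prG : prime #|G| by rewrite cG.
  have oy : #[y] = q by rewrite orderE -Gy.
  have Gy' n : y ^+ n \in Gpart B by rewrite -[Gpart B]/(G : {set B}) Gy mem_cycle.
  have Ex' n : x ^+ n \in idempotents B.
    by rewrite -[idempotents B]/(E : {set B}) Ex mem_cycle.
  have fD (a b : 'Z_p * 'Z_q) :
      pair_exp x y (b.1, (a.2 + b.2)%R) = pair_exp x y a [+] pair_exp x y b.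
    by rewrite (idempotents_norm_sadd cancB prG nE) // /pair_exp /= -expg_ZpD.
  apply: Or44; case: fM => fM; last first.
    apply: Or31; split; last exact: Gpart_semidirect_EG.
      exact: (@isomorphic_from _ (semidirect_EG alpha) _ fbij fD fM).
    exact: idempotents_semidirect_EG.
  apply: Or33; split; last exact: idempotents_direct_GE; last exact: Gpart_direct_GE.
  (* [pair_exp] lists the subgroup of order p first, here [E], whereas [direct_GE] lists [G]
     first. *)
  pose swap (u : direct_GE q p) : 'Z_p * 'Z_q := (u.2, u.1).
  have swap_bij : bijective swap by exists (fun u => (u.2, u.1)) => -[].
  apply: (@isomorphic_from _ (direct_GE q p) _ (bij_comp fbij swap_bij)).
    by move=> a b; rewrite /= -fD.
  by move=> a b; rewrite /= -fM.
Qed.
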